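(* Let $n$ nodes run the algorithm TLCB described in the context. Suppose $0<t_r\le n-f$, $0<t_s\le t_r$, $t_r+t_s>n$, and $0<t_b\le n-f_b$ where $f_b=t_r(n-t_r)/(t_r-t_s+1)$, and at most $f$ nodes fail. Then TLCB (with the $k$-th call to TLCB on a node constituting that node's $k$-th logical time-step) implements a $\mathrm{TSB}(t_r,t_b,n)$ full-spread broadcast abstraction.
   Context: Asynchronous network model. There are $n$ nodes numbered $1,\dots,n$; nodes may fail only by crashing permanently, after which they send no messages. A network-level Broadcast sends a message to all $n$ nodes (including the sender). Every message sent to a node that does not fail is eventually delivered after an arbitrary finite delay, and messages between each pair of nodes are delivered in the order sent. $\mathrm{Receive}()$ waits for and returns the next delivered message. Algorithm TLCR (node $i$, receive threshold $t_r$). Persistent state: a list $\vec R$ of sets, initially $[\{\}]$; $\vec R_k$ is its $k$-th element. On a call $\mathrm{TLCR}(m)$: append $\{\}$ to $\vec R$ and let $s=|\vec R|$; network-broadcast $\langle i,m,s,\vec R_{s-1}\rangle$; while $|\vec R_s|<t_r$: receive $\langle j,m',s',R'\rangle$; if $s'=s$, add $\langle j,m'\rangle$ to $\vec R_s$; else if $s'>s$, set $\vec R_s\leftarrow\vec R_s\cup R'$ (messages with $s'<s$ are ignored). Return $(\{m'\mid\langle j,m'\rangle\in\vec R_s\},\{\})$. Algorithm TLCB (node $i$, thresholds $t_r$, $t_s\le t_r$), built on TLCR with receive threshold $t_r$. On a call $\mathrm{TLCB}(m)$: $(R',\_)\leftarrow\mathrm{TLCR}(m)$; $(R'',\_)\leftarrow\mathrm{TLCR}(R')$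 (so $R''$ is a set of message-sets); $R\leftarrow R'\cup\bigcup_{X\in R''}X$; $B\leftarrow\{m'\mid$ at least $t_s$ of the message-sets in $R''$ contain $m'\}$; return $(R,B)$. Thus each TLCB step uses two TLCR steps. Threshold synchronous broadcast. A primitive, called once per logical time-step by each non-failed node with a message $m$ and returning a pair $(R,B)$ of message sets, provides $\mathrm{TSB}(t_r,t_b,t_s)$ if: (lock-step synchrony) a call at step $s$ returns (completing step $s$) unless the node fails first; (receive threshold) if node $i$'s call at step $s$ returns $(R,B)$, there is $N_R\subseteq\{1,\dots,n\}$ with $|N_R|\ge t_r$ such that $R$ is exactly the set of messages broadcast by the nodes of $N_R$ in step $s$; (broadcast threshold) there is $N_B\subseteq\{1,\dots,n\}$ with $|N_B|\ge t_b$ such that $B$ is exactly the set of messages broadcast by the nodes of $N_B$ in step $s$; (spread threshold) each $m'\in B$ returned to any node at step $s$ is contained in the receive sets $R$ returned in step $s$ to at least $t_s$ nodes (counting nodes that fail before completing step $s$ but would otherwise have received $m'$). Full-spread means $t_s=n$.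
   Formalization: In TLCB, B counts the message-sets in R'' once per sender rather than as distinct sets: with distinct sets the claim fails (e.g. n = t_r = t_s = t_b = 2, f = 0: both nodes gather the same set, R'' has one element and B is empty). *)

(* Defs.v *)
From HB Require Import structures.
From mathcomp Require Import all_boot all_order all_algebra.
From mathcomp Require Import finmap.
Set Implicit Arguments. Unset Strict Implicit. Unset Printing Implicit Defensive.
Local Open Scope fset_scope.

Section TLC.
Variables (M : choiceType) (n : nat).

Definition node := 'I_n.

(* The value m' carried by a TLCR step: inside TLCB the first TLCR step
   carries an application message, the second one a set of messages. *)
Definition payload := (M + {fset M})%type.

Definition get1 (p : payload) : option M :=
  if p is inl m then Some m else None.
Definition get2 (p : payload) : {fset M} :=
  if p is inr X then X else fset0.

(* A network message <j, m', s', R'>; the sender j is the source of the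
   (authenticated, FIFO) channel it travels on. *)
Record netmsg := NetMsg {
  nm_pl   : payload;
  nm_step : nat;
  nm_prev : {fset (node * payload)} }.   (* R' = sender's R_{s'-1} *)

Inductive phase :=
  | Idle
  | Wait1                       (* inside the first TLCR of a TLCB call *)
  | Wait2 of {fset M}.          (* inside the second TLCR; carries R' *)

Record lstate := LState {
  ls_R     : nat -> {fset (node * payload)};  (* \vec R_k, k = 1..ls_s *)
  ls_s     : nat;
  ls_k     : nat;                             (* number of TLCB calls made *)
  ls_phase : phase;
  ls_crashed : bool;
  ls_inp   : nat -> option M;                 (* message of k-th TLCB call *)
  ls_out   : nat -> option ({fset M} * {fset M}) }. (* (R,B) of k-th call *)

Record gstate := GState {
  gs_loc  : node -> lstate;
  gs_chan : node -> node -> seq netmsg }.     (* gs_chan j i : FIFO j -> i *)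

Inductive event :=
  | Invoke of node & M
  | Recv of node & node    (* Recv i j : node i's Receive() returns the head
                              of the channel from j *)
  | Crash of node
  | Stutter.

Definition upd {A : eqType} {B : Type} (f : A -> B) (x : A) (v : B) :=
  fun y => if y == x then v else f y.

Definition init_lstate : lstate :=
  LState (fun _ => fset0) 1 0 Idle false (fun _ => None) (fun _ => None).
(* \vec R is initially [{}], so |\vec R| = 1 and R_1 = {}. *)

Definition init_gstate : gstate :=
  GState (fun _ => init_lstate) (fun _ _ => [::]).

Definition bcast_chan (ch : node -> node -> seq netmsg) (i : node) (w : netmsg) :=
  fun j d => if j == i then rcons (ch j d) w else ch j d.

Definition vals1 (X : {fset (node * payload)}) : {fset M} :=
  [fset x in pmap get1 [seq p.2 | p <- X]].

Section Step.
Variables (tr ts : nat).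

Inductive step : gstate -> event -> gstate -> Prop :=
  | StInvoke (g : gstate) (i : node) (m : M) :
      let l := gs_loc g i in
      ~~ ls_crashed l -> ls_phase l = Idle ->
      let s := (ls_s l).+1 in
      let k := (ls_k l).+1 in
      let l' := LState (upd (ls_R l) s fset0) s k Wait1 false
                       (upd (ls_inp l) k (Some m)) (ls_out l) in
      step g (Invoke i m)
        (GState (upd (gs_loc g) i l')
                (bcast_chan (gs_chan g) i (NetMsg (inl m) s (ls_R l (s.-1)))))
  | StRecv (g : gstate) (i j : node) (w : netmsg) (rest : seq netmsg) :
      let l := gs_loc g i in
      ~~ ls_crashed l -> ls_phase l <> Idle ->
      gs_chan g j i = w :: rest ->
      let s := ls_s l in
      let Rs := ls_R l s in
      let Rs' := if nm_step w == s then (j, nm_pl w) |` Rs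
                 else if s < nm_step w then Rs `|` nm_prev w
                 else Rs in
      let R1 := upd (ls_R l) s Rs' in
      let ch1 := upd (gs_chan g) j (upd (gs_chan g j) i rest) in
      let g' :=
        if #|` Rs'| < tr then
          (* still inside the while loop of TLCR *)
          GState (upd (gs_loc g) i
                    (LState R1 s (ls_k l) (ls_phase l) false (ls_inp l) (ls_out l)))
                 ch1
        else
          match ls_phase l with
          | Wait2 R' =>
              (* second TLCR returns R'' (pairs Rs'); TLCB returns (R,B) *)
              let R := R' `|` \bigcup_(p <- Rs') get2 p.2 in
              let B := [fset x in R |
                         ts <= #|` [fset p in Rs' | x \in get2 p.2]|] in
              GState (upd (gs_loc g) i
                        (LState R1 s (ls_k l) Idle false (ls_inp l)
                                (upd (ls_out l) (ls_k l) (Some (R, B)))))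
                     ch1
          | _ =>
              (* first TLCR returns R' ; start second TLCR(R') *)
              let R' := vals1 Rs' in
              GState (upd (gs_loc g) i
                        (LState (upd R1 s.+1 fset0) s.+1 (ls_k l) (Wait2 R') false
                                (ls_inp l) (ls_out l)))
                     (bcast_chan ch1 i (NetMsg (inr R') s.+1 Rs'))
          end in
      step g (Recv i j) g'
  | StCrash (g : gstate) (i : node) :
      let l := gs_loc g i in
      ~~ ls_crashed l ->
      step g (Crash i)
        (GState (upd (gs_loc g) i
                   (LState (ls_R l) (ls_s l) (ls_k l) (ls_phase l) true
                           (ls_inp l) (ls_out l)))
                (gs_chan g))
  | StStutter (g : gstate) : step g Stutter g.

End Step.

Definition crashed_at (sigma : nat -> gstate) t (i : node) :=
  ls_crashed (gs_loc (sigma t) i).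

Definition correct (sigma : nat -> gstate) (i : node) :=
  forall t, ~~ crashed_at sigma t i.

Definition valid_exec (tr ts f : nat) (sigma : nat -> gstate) (ev : nat -> event) :=
  [/\ sigma 0 = init_gstate,
      (forall t, step tr ts (sigma t) (ev t) (sigma t.+1)),
      (forall t, #|[set i : node | crashed_at sigma t i]| <= f),
      (* every message sent to a node that does not fail is eventually
         received (channels are FIFO, so it suffices for the head) *)
      (forall (i j : node) t, correct sigma i ->
         gs_chan (sigma t) j i <> [::] ->
         exists2 t', t <= t' & ev t' = Recv i j) &
      (forall (i : node) t, correct sigma i ->
         ls_phase (gs_loc (sigma t) i) = Idle ->
         exists2 t', t <= t' & exists m, ev t' = Invoke i m)].

Definition bcast_in (sigma : nat -> gstate) (j : node) (k : nat) (m : M) :=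
  exists t, ls_inp (gs_loc (sigma t) j) k = Some m.

Definition returned (sigma : nat -> gstate) (i : node) (k : nat) R B :=
  exists t, ls_out (gs_loc (sigma t) i) k = Some (R, B).

Definition exactly_from (sigma : nat -> gstate) (N : {set node}) (k : nat)
  (X : {fset M}) :=
  (forall j, j \in N -> exists m, bcast_in sigma j k m) /\
  (forall x, x \in X <-> exists2 j, j \in N & bcast_in sigma j k x).

Definition TSB (sigma : nat -> gstate) (tr tb ts : nat) :=
  [/\
      (forall (i : node) k m, bcast_in sigma i k m -> correct sigma i ->
         exists R B, returned sigma i k R B),
      (forall (i : node) k R B, returned sigma i k R B ->
         exists N : {set node}, tr <= #|N| /\ exactly_from sigma N k R),
      (forall (i : node) k R B, returned sigma i k R B ->
         exists N : {set node}, tb <= #|N| /\ exactly_from sigma N k B) &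
      (forall (i : node) k R B, returned sigma i k R B ->
         forall x, x \in B ->
         exists N : {set node}, ts <= #|N| /\
           forall j, j \in N -> forall R' B', returned sigma j k R' B' ->
             x \in R')].

End TLC.

Definition f_b (n tr ts : nat) : rat :=
  ((tr * (n - tr))%:R / (tr - ts + 1)%:R)%R.

(* Main.v *)
(* Safety is counting: two threshold sets of sizes [ts] and [tr] of senders
   intersect, and double counting over the sets gathered in the second TLCR step
   bounds the number of messages supported by fewer than [ts] of them.
   Liveness is delicate because a message of step [s] that reaches a node still in
   step [s - 1] moves that node to step [s] but is itself dropped.  The first
   correct node to enter step [s] drops no message of a correct node, so it
   completes the step; its next message then carries a full receive set and
   releases every other correct node. *)
Require Import Defs.
From HB Require Import structures.
From mathcomp Require Import all_boot all_order all_algebra.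
From mathcomp Require Import finmap.
From mathcomp Require Import zify boolp.

Set Implicit Arguments. Unset Strict Implicit. Unset Printing Implicit Defensive.

Import Order.TTheory GRing.Theory Num.Theory.

(** Clears the denominator of [f_b]: double counting gives an inequality between naturals, with [b]
    the number of nodes whose message ends up in [B]. *)
Lemma f_b_bound n tr ts tb b : b <= n ->
  (n - b) * (tr - ts + 1) <= tr * (n - tr) ->
  (tb%:R <= n%:R - f_b n tr ts :> rat)%R -> tb <= b.
Proof.
move=> hb h htb; rewrite -(ler_nat rat); apply: le_trans htb _.
rewrite lerBlDl -lerBlDr -natrB // /f_b ler_pdivlMr ?ltr0n ?addn1 //.
by rewrite -natrM ler_nat -addn1.
Qed.

(** * State of a single node: invariant and evolution in time *)

Section TLCB.
Local Open Scope fset_scope.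
Variables (M : choiceType) (n tr ts : nat).
Implicit Types (l : lstate M n) (g : gstate M n) (e : event M n).
Implicit Types (X : {fset (node n * payload M)}) (w : netmsg M n).

(** The last completed TLCR step. The initial list counts as a completed step 1, so call [k]
    occupies the steps [k.*2] and [k.*2.+1]. *)
Definition dn l := if ls_phase l is Idle then ls_s l else (ls_s l).-1.

(** The payload sent in step [s], recomputed from the state of the sender, so that no log of sent
    messages has to be kept. *)
Definition pl l s : payload M :=
  if odd s then inr (vals1 (ls_R l s.-1))
  else if ls_inp l s./2 is Some m then inl m else inr fset0.

Definition msg l s := NetMsg (pl l s) s (ls_R l s.-1).

Definition outR X1 X2 : {fset M} := vals1 X1 `|` \bigcup_(p <- X2) get2 p.2.

Definition outB X1 X2 : {fset M} :=
  [fset x in outR X1 X2 | ts <= #|` [fset p in X2 | x \in get2 p.2]|].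

Definition phase_ok l :=
  match ls_phase l with
  | Idle => ls_s l = (ls_k l).*2.+1
  | Wait1 => 0 < ls_k l /\ ls_s l = (ls_k l).*2
  | Wait2 R' => [/\ 0 < ls_k l, ls_s l = (ls_k l).*2.+1
                  & R' = vals1 (ls_R l (ls_k l).*2)]
  end.

(** Through [linv_out] the outputs are functions of the receive sets, so safety can be argued on
    these sets alone. *)
Record linv l : Prop := LInv {
  linv_phase : phase_ok l;
  linv_inp : forall k, isSome (ls_inp l k) = (0 < k <= ls_k l);
  linv_done : forall s, 2 <= s <= dn l -> tr <= #|` ls_R l s|;
  linv_wait : ls_phase l <> Idle _ -> #|` ls_R l (ls_s l)| < tr;
  linv_out : forall k, ls_out l k =
    if (0 < k) && (k.*2.+1 <= dn l)
    then Some (outR (ls_R l k.*2) (ls_R l k.*2.+1),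
               outB (ls_R l k.*2) (ls_R l k.*2.+1))
    else None }.

(** The preorder of evolution: the set of an open step only grows and is frozen once the step is
    completed. *)
Record ext l l' : Prop := Ext {
  ext_s : ls_s l <= ls_s l';
  ext_dn : dn l <= dn l';
  ext_done : forall s, s <= dn l -> ls_R l' s = ls_R l s;
  ext_R : forall s, s <= ls_s l -> ls_R l s `<=` ls_R l' s;
  ext_inp : forall k m, ls_inp l k = Some m -> ls_inp l' k = Some m;
  ext_out : forall k RB, ls_out l k = Some RB -> ls_out l' k = Some RB;
  ext_crashed : ls_crashed l -> ls_crashed l' }.

Lemma ext_refl l : ext l l.
Proof. by split. Qed.

Lemma s_le_dn l : ls_s l <= (dn l).+1.
Proof. by rewrite /dn; case: (ls_phase l) => // *; lia. Qed.

Lemma dn_wait l : ls_phase l <> Idle _ -> dn l = (ls_s l).-1.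
Proof. by rewrite /dn; case: (ls_phase l). Qed.

Lemma dn_idle l : ls_phase l = Idle _ -> dn l = ls_s l.
Proof. by rewrite /dn => ->. Qed.

Lemma ext_trans l1 l2 l3 : ext l1 l2 -> ext l2 l3 -> ext l1 l3.
Proof.
move=> [s1 d1 D1 R1 i1 o1 c1] [s2 d2 D2 R2 i2 o2 c2]; split; try by [lia|auto].
- by move=> s hs; rewrite D2 ?D1 //; lia.
- by move=> s hs; apply: fsubset_trans (R1 _ hs) (R2 _ _); lia.
Qed.

Lemma linv_wait_ge2 l : linv l -> ls_phase l <> Idle _ -> 2 <= ls_s l.
Proof. by move=> [+ _ _ _ _]; rewrite /phase_ok; case: (ls_phase l) => // [|R'] []; lia. Qed.

Lemma linv_s l : linv l -> (ls_k l).*2 <= ls_s l <= (ls_k l).*2.+1.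
Proof. by move=> [+ _ _ _ _]; rewrite /phase_ok; case: (ls_phase l) => [|[]|R' []]; lia. Qed.

(** The payload of step [s] depends on an input, which is never overwritten, or on the set of step
    [s.-1], frozen since step [s] was entered. Messages in transit can thus be described through the
    current state of their sender. *)
Lemma pl_ext l l' s : linv l -> ext l l' -> 2 <= s <= ls_s l -> pl l' s = pl l s.
Proof.
move=> il el hs; rewrite /pl; case: ifP => os.
  by rewrite (ext_done el) //; have := s_le_dn l; lia.
have : isSome (ls_inp l s./2) by rewrite (linv_inp il); have := linv_s il; lia.
by case E: (ls_inp l s./2) => [m|//] _; rewrite (ext_inp el E).
Qed.

Lemma msg_ext l l' s : linv l -> ext l l' -> 2 <= s <= ls_s l -> msg l' s = msg l s.
Proof.
move=> il el hs; rewrite /msg (pl_ext il el hs) (ext_done el) //.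
by have := s_le_dn l; lia.
Qed.

(** * Preservation of the local invariant by each kind of event *)

Lemma invoke_ok l m : linv l -> ~~ ls_crashed l -> ls_phase l = Idle _ -> 0 < tr ->
  let l' := LState (upd (ls_R l) (ls_s l).+1 fset0) (ls_s l).+1 (ls_k l).+1 (Wait1 _) false
                   (upd (ls_inp l) (ls_k l).+1 (Some m)) (ls_out l) in
  linv l' /\ ext l l'.
Proof.
move=> il nc ph t0 l'; have [P I D W O] := il.
have hd : dn l = ls_s l by exact: dn_idle.
move: P; rewrite /phase_ok ph => P.
split; split; rewrite /l' /phase_ok /dn /upd /= ?ph.
- by lia.
- by move=> k; case: eqP => [->|hk] /=; rewrite ?I; lia.
- by move=> s hs; case: eqP => [|_]; [lia | apply: D; lia].
- by move=> _; rewrite eqxx cardfs0.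
- move=> k; rewrite O hd; case: ifP => // hk.
  by rewrite !ifF //; lia.
- by [].
- by lia.
- by move=> s hs; rewrite ifF //; lia.
- by move=> s hs; rewrite ifF //; lia.
- move=> k m' hk; rewrite ifF //; have := I k; rewrite hk /=; lia.
- by [].
- by rewrite (negbTE nc).
Qed.

Lemma crash_ok l : linv l ->
  let l' := LState (ls_R l) (ls_s l) (ls_k l) (ls_phase l) true (ls_inp l) (ls_out l) in
  linv l' /\ ext l l'.
Proof. by case=> *; split; split. Qed.

Section Receive.
Variables (l : lstate M n) (X : {fset (node n * payload M)}).
Hypotheses (il : linv l) (nc : ~~ ls_crashed l) (ph : ls_phase l <> Idle _).
Hypothesis hX : ls_R l (ls_s l) `<=` X.

Lemma recv_ok : #|` X| < tr ->
  let l' := LState (upd (ls_R l) (ls_s l) X) (ls_s l) (ls_k l) (ls_phase l) false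
                   (ls_inp l) (ls_out l) in
  linv l' /\ ext l l'.
Proof.
move=> cX l'; have [P I D W O] := il.
have hd : dn l = (ls_s l).-1 by exact: dn_wait.
have hd' : dn l' = (ls_s l).-1 by exact: dn_wait.
have s2 := linv_wait_ge2 il ph.
split; split; rewrite ?hd' ?hd /l' /phase_ok /upd /= //.
- move: P; rewrite /phase_ok; case: (ls_phase l) => // R' [k0 -> ->].
  by split=> //; rewrite ifF //; lia.
- by move=> s hs; rewrite ifF; [apply: D|]; lia.
- by rewrite eqxx.
- move=> k; rewrite O hd; case: ifP => // hk.
  by rewrite !ifF //; lia.
- by move=> s hs; rewrite ifF //; lia.
- by move=> s hs; case: eqP => [->|_].
- by rewrite (negbTE nc).
Qed.

Lemma recv_next_ok : 0 < tr -> tr <= #|` X| -> ls_phase l = Wait1 _ ->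
  let l' := LState (upd (upd (ls_R l) (ls_s l) X) (ls_s l).+1 fset0) (ls_s l).+1 (ls_k l)
                   (Wait2 (vals1 X)) false (ls_inp l) (ls_out l) in
  linv l' /\ ext l l'.
Proof.
move=> t0 cX ph1 l'; have [P I D W O] := il.
have hd : dn l = (ls_s l).-1 by exact: dn_wait.
have hd' : dn l' = ls_s l by [].
have s2 := linv_wait_ge2 il ph.
move: P; rewrite /phase_ok ph1 => -[k0 P].
split; split; rewrite ?hd' ?hd /l' /phase_ok /upd /= //.
- by split=> //; [lia|rewrite ifF ?ifT //; lia].
- move=> s hs; rewrite ifF; last by lia.
  by case: eqP => // hs'; apply: D; lia.
- by rewrite eqxx cardfs0.
- move=> k; rewrite O hd; case: ifP => hk; last by rewrite ifF //; lia.
  by rewrite ifT; [rewrite !ifF // | ]; lia.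
- by lia.
- by move=> s hs; rewrite !ifF //; lia.
- move=> s hs; rewrite ifF; last by lia.
  by case: eqP => [->|_].
- by rewrite (negbTE nc).
Qed.

Lemma recv_return_ok R' : tr <= #|` X| -> ls_phase l = Wait2 R' ->
  let R := R' `|` \bigcup_(p <- X) get2 p.2 in
  let B := [fset x in R | ts <= #|` [fset p in X | x \in get2 p.2]|] in
  let l' := LState (upd (ls_R l) (ls_s l) X) (ls_s l) (ls_k l) (Idle _) false (ls_inp l)
                   (upd (ls_out l) (ls_k l) (Some (R, B))) in
  linv l' /\ ext l l'.
Proof.
move=> cX ph2 R B l'; have [P I D W O] := il.
have hd : dn l = (ls_s l).-1 by exact: dn_wait.
have hd' : dn l' = ls_s l by [].
have s2 := linv_wait_ge2 il ph.
move: P; rewrite /phase_ok ph2 => -[k0 P eR].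
split; split; rewrite ?hd' ?hd /l' /phase_ok /upd /= //.
- by move=> s hs; case: eqP => // hs'; apply: D; lia.
- move=> k; case: eqP => [->|hk].
    rewrite ifT; last by lia.
    by rewrite -P eqxx ifF; [rewrite /outB /outR -eR | lia].
  rewrite O hd; case: ifP => hk'; last by rewrite ifF //; lia.
  by rewrite ifT ?ifF //; lia.
- by lia.
- by move=> s hs; rewrite !ifF //; lia.
- by move=> s hs; case: eqP => [->|_].
- move=> k RB hk; rewrite ifF //; move: hk; rewrite O hd; case: ifP => //; lia.
- by rewrite (negbTE nc).
Qed.
End Receive.

(** * Effect of one global transition *)

Definition newR l (j : node n) w :=
  if nm_step w == ls_s l then (j, nm_pl w) |` ls_R l (ls_s l)
  else if ls_s l < nm_step w then ls_R l (ls_s l) `|` nm_prev w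
  else ls_R l (ls_s l).

Lemma sub_newR l j w : ls_R l (ls_s l) `<=` newR l j w.
Proof.
by rewrite /newR; do 2?case: ifP => _; rewrite ?fsubsetUr ?fsubsetUl.
Qed.

Definition recvs e (j d : node n) : bool :=
  if e is Recv i j' then (i == d) && (j' == j) else false.

Definition recv_effect g i j l' :=
  exists w rest, [/\ gs_chan g j i = w :: rest, ls_phase (gs_loc g i) <> Idle _,
    ls_R l' (ls_s (gs_loc g i)) = newR (gs_loc g i) j w
    & dn l' = (dn (gs_loc g i) + (tr <= #|` newR (gs_loc g i) j w|))%N].

(** What later arguments use about a transition, uniformly in the event. The [nseq] in [ss_chan] has
    length 0 or 1: a node broadcasts exactly when it enters a new step. *)
Record step_sum g e g' : Prop := StepSum {
  ss_linv : forall i, linv (gs_loc g' i);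
  ss_ext : forall i, ext (gs_loc g i) (gs_loc g' i);
  ss_s : forall i, ls_s (gs_loc g' i) <= (ls_s (gs_loc g i)).+1;
  ss_chan : forall j d, gs_chan g' j d =
    (if recvs e j d then behead (gs_chan g j d) else gs_chan g j d)
    ++ nseq (ls_s (gs_loc g' j) - ls_s (gs_loc g j))
            (msg (gs_loc g' j) (ls_s (gs_loc g' j)));
  ss_R : forall i s x, x \in ls_R (gs_loc g' i) s ->
    x \in ls_R (gs_loc g i) s \/ s = ls_s (gs_loc g i) /\ exists j, e = Recv M i j;
  ss_recv : forall i j, e = Recv M i j -> recv_effect g i j (gs_loc g' i);
  ss_invoke : forall i m, e = Invoke i m ->
    ls_s (gs_loc g' i) = (ls_s (gs_loc g i)).+1 }.

Lemma mk_step_sum g e i l' ch : (forall i, linv (gs_loc g i)) ->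
  linv l' /\ ext (gs_loc g i) l' -> ls_s l' <= (ls_s (gs_loc g i)).+1 ->
  (forall j d, ch j d =
    (if recvs e j d then behead (gs_chan g j d) else gs_chan g j d)
    ++ (if j == i then nseq (ls_s l' - ls_s (gs_loc g i)) (msg l' (ls_s l')) else [::])) ->
  (forall s x, x \in ls_R l' s ->
    x \in ls_R (gs_loc g i) s \/ s = ls_s (gs_loc g i) /\ exists j, e = Recv M i j) ->
  (forall i' j, e = Recv M i' j -> i' = i /\ recv_effect g i j l') ->
  (forall i' m, e = Invoke i' m -> i' = i /\ ls_s l' = (ls_s (gs_loc g i)).+1) ->
  step_sum g e (GState (upd (gs_loc g) i l') ch).
Proof.
move=> il [il' el] hs hch hR hr hi; split; rewrite /= /upd.
- by move=> x; case: eqP.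
- by move=> x; case: eqP => [->|_] //; exact: ext_refl.
- by move=> x; case: eqP => [->|_].
- by move=> j d; rewrite hch; case: eqP => [->|_] //; rewrite subnn.
- by move=> x s y; case: eqP => [->|_]; [apply: hR | left].
- by move=> x j /hr [-> h]; rewrite eqxx.
- by move=> x m /hi [-> h]; rewrite eqxx.
Qed.

Lemma consume_chan g i j w rest : gs_chan g j i = w :: rest -> forall a d,
  upd (gs_chan g) j (upd (gs_chan g j) i rest) a d =
  if recvs (Recv M i j) a d then behead (gs_chan g a d) else gs_chan g a d.
Proof.
move=> hw a d; rewrite /upd /recvs (eq_sym i) (eq_sym j).
by case: (a =P j) => [->|_]; case: (d =P i) => [->|_] //=; rewrite hw.
Qed.

Lemma step_spec g e g' : 0 < tr -> (forall i, linv (gs_loc g i)) ->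
  step tr ts g e g' -> step_sum g e g'.
Proof.
move=> t0 il st.
case: st il => {g e g'} [g i m l nc ph s k l'|g i j w rest l nc ph hw s Rs Rs' R1 ch1 g'
  |g i l nc|g] il.
- have [il' el] := invoke_ok m (il i) nc ph t0.
  apply: mk_step_sum => //.
  + move=> j d; rewrite /bcast_chan /= subSnn; case: eqP => [->|_]; last by rewrite cats0.
    (* An idle node sits on an odd step, so the new step is even and its message carries the fresh
       input. *)
    have := linv_phase (il i); rewrite /phase_ok ph => hs.
    rewrite -cats1; congr (_ ++ [:: _]).
    rewrite /msg /pl /= /s /upd [l]lock /= -lock hs /= negbK odd_double /= doubleK /k eqxx.
    by rewrite ifF //; lia.
  + by move=> s' x; rewrite /= /upd; case: eqP => // _; left.
  + by move=> i' m' [<- _].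
- have hsub : Rs `<=` Rs' by exact: sub_newR.
  have hd : dn l = s.-1 by exact: dn_wait.
  have s2 : 2 <= s by exact: linv_wait_ge2 (il i) ph.
  rewrite /g'; case: ifP => cR.
    apply: mk_step_sum => //; first by exact: (recv_ok (il i) nc ph hsub cR).
    + by move=> a d; rewrite /ch1 (consume_chan hw) /= subnn /= if_same cats0.
    + move=> s' x /=; rewrite /R1 /upd; case: eqP => [->|_]; last by left.
      by right; split=> //; exists j.
    + move=> i' j' [<- <-]; split=> //; exists w, rest; split=> //=.
        by rewrite /R1 /upd eqxx.
      by rewrite leqNgt cR /= addn0 /dn.
  have cR' : tr <= #|` Rs'| by rewrite leqNgt cR.
  case ph': (ls_phase l) => [||R']; first by case: ph.
    apply: mk_step_sum => //; first by exact: (recv_next_ok (il i) nc ph hsub t0 cR' ph').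
    + move=> a d; rewrite /bcast_chan /ch1 (consume_chan hw) /= subSnn.
      case: (a =P i) => [->|_]; last by case: ifP; rewrite cats0.
      rewrite -cats1; congr (_ ++ [:: _]).
      have := linv_phase (il i); rewrite /phase_ok -/l ph' => -[_ hs].
      by rewrite /msg /pl /= /R1 /upd /s -/l hs odd_double /= (ltn_eqF (ltnSn _)) eqxx.
    + move=> s' x /=; rewrite /R1 /upd; case: eqP => // _; case: eqP => [->|_]; last by left.
      by right; split=> //; exists j.
    + move=> i' j' [<- <-]; split=> //; exists w, rest; split=> //=.
        by rewrite /R1 /upd (ltn_eqF (ltnSn _)) eqxx.
      by rewrite -/l hd cR' /dn /=; lia.
  apply: mk_step_sum => //; first by exact: (recv_return_ok (il i) nc ph hsub cR' ph').
  + by move=> a d; rewrite /ch1 (consume_chan hw) /= subnn /= if_same cats0.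
  + move=> s' x /=; rewrite /R1 /upd; case: eqP => [->|_]; last by left.
    by right; split=> //; exists j.
  + move=> i' j' [<- <-]; split=> //; exists w, rest; split=> //=.
      by rewrite /R1 /upd eqxx.
    by rewrite -/l hd cR' /dn /=; lia.
- apply: mk_step_sum => //; first by exact: crash_ok (il i).
  + by move=> j d; rewrite /= subnn; case: eqP; rewrite cats0.
  + by move=> s x /=; left.
- split=> //.
  + by move=> j d; rewrite /= subnn cats0.
  + by left.
Qed.

(** * Global invariant on channels and receive sets *)

(** The step of the next message that [i] will read from [j]: a channel holds the messages of
    consecutive steps up to the current step of [j], so its length determines this number. *)
Definition nxt g (j i : node n) := (ls_s (gs_loc g j)).+1 - size (gs_chan g j i).

(** [inv_nxt] is the synchrony bound: who has read a message of step [v] has completed step [v.-1],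
    so a node waiting in step [s] meets messages of step at most [s.+1]. [inv_R] says that entries
    are genuine, whichever route they took. *)
Record inv g : Prop := Inv {
  inv_linv : forall i, linv (gs_loc g i);
  inv_size : forall j i, size (gs_chan g j i) < ls_s (gs_loc g j);
  inv_chan : forall j i, gs_chan g j i =
    [seq msg (gs_loc g j) s | s <- iota (nxt g j i) (size (gs_chan g j i))];
  inv_nxt : forall j i, nxt g j i <= (dn (gs_loc g i)).+2;
  inv_R : forall i j s p, (j, p) \in ls_R (gs_loc g i) s ->
    2 <= s <= ls_s (gs_loc g j) /\ p = pl (gs_loc g j) s }.

Lemma inv_init : inv (init_gstate M n).
Proof.
split=> // i; split=> //=.
- by move=> k; case: k.
- by move=> s; rewrite /dn /=; lia.
- by move=> k; rewrite /dn /=; case: k.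
Qed.

Lemma inv_head g j i w rest : inv g -> gs_chan g j i = w :: rest ->
  [/\ w = msg (gs_loc g j) (nxt g j i), 2 <= nxt g j i <= ls_s (gs_loc g j)
    & rest = [seq msg (gs_loc g j) s | s <- iota (nxt g j i).+1 (size rest)]].
Proof.
move=> ig hw; have := inv_chan ig j i; have := inv_size ig j i.
rewrite hw /= => hs [hw' hr]; split=> //.
by rewrite /nxt hw /=; lia.
Qed.

Lemma nxt_step g e g' j i : inv g -> step_sum g e g' ->
  nxt g' j i = (nxt g j i + recvs e j i)%N.
Proof.
move=> ig st; rewrite /nxt (ss_chan st) size_cat size_nseq.
have hs := ext_s (ss_ext st j); have hz := inv_size ig j i.
case: ifP => [|_]; last by lia.
rewrite /recvs; case: e st => // i' j' st /andP [/eqP ei /eqP ej].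
rewrite {}ei {}ej in st; have [w [rest [hw _ _ _]]] := ss_recv st erefl.
by move: hz; rewrite hw /=; lia.
Qed.

(* A message from a later step always ends the wait: it is from the very next
   step, so the set it carries is the completed receive set of the current one. *)
Lemma newR_full g j i w rest : inv g -> gs_chan g j i = w :: rest ->
  ls_phase (gs_loc g i) <> Idle _ -> ls_s (gs_loc g i) < nxt g j i ->
  tr <= #|` newR (gs_loc g i) j w|.
Proof.
move=> ig hw ph hlt; have [-> hj _] := inv_head ig hw.
have := inv_nxt ig j i; have s2 := linv_wait_ge2 (inv_linv ig i) ph.
rewrite /newR /= (dn_wait ph) => hn; rewrite gtn_eqF // hlt.
apply: leq_trans (fsubset_leq_card (fsubsetUr _ _)).
have hd := s_le_dn (gs_loc g j).
by apply: (linv_done (inv_linv ig j)); lia.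
Qed.

(** Entries adopted from a later message fall under [inv_R] at its sender, because by [inv_nxt] the
    set it carries belongs to the current step of [i]. *)
Lemma inv_newR g j i w rest : inv g -> gs_chan g j i = w :: rest ->
  ls_phase (gs_loc g i) <> Idle _ -> forall a p,
  (a, p) \in newR (gs_loc g i) j w ->
  2 <= ls_s (gs_loc g i) <= ls_s (gs_loc g a)
  /\ p = pl (gs_loc g a) (ls_s (gs_loc g i)).
Proof.
move=> ig hw ph a p; have [-> hj _] := inv_head ig hw.
have := inv_nxt ig j i; have s2 := linv_wait_ge2 (inv_linv ig i) ph.
rewrite /newR /= (dn_wait ph) => hn; case: eqP => [hs|hs].
  by case/fset1UP => [[-> ->]|/(inv_R ig)//]; split; rewrite -?hs.
case: ifP => [hlt|_ /(inv_R ig)//].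
by rewrite in_fsetU => /orP [|] /(inv_R ig) //;
  rewrite (_ : (nxt g j i).-1 = ls_s (gs_loc g i)) //; lia.
Qed.

Lemma inv_step g e g' : inv g -> step_sum g e g' -> inv g'.
Proof.
move=> ig st; have il := inv_linv ig.
have hs j i := nxt_step j i ig st.
have he j := ext_s (ss_ext st j).
split; first exact: ss_linv st.
- move=> j i; have := hs j i; have hj := ss_s st j; have hz := inv_size ig j i; have := he j.
  by rewrite /nxt; lia.
- move=> j i; rewrite hs; set c := gs_chan g' j i; have := ss_chan st j i; rewrite -/c => hc.
  have hz := inv_size ig j i; have hj := ss_s st j; have hej := he j.
  have hm s : 2 <= s <= ls_s (gs_loc g j) -> msg (gs_loc g' j) s = msg (gs_loc g j) s.
    by apply: msg_ext (il j) (ss_ext st j).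
  have hmm a k : 2 <= a -> a + k <= (ls_s (gs_loc g j)).+1 ->
      [seq msg (gs_loc g j) s | s <- iota a k] = [seq msg (gs_loc g' j) s | s <- iota a k].
    by move=> ha hk; apply/eq_in_map => s; rewrite mem_iota => hs'; rewrite hm //; lia.
  (* What remains of the old channel: the messages from the new [nxt] up to the old step of [j]. A
     broadcast extends this run by one. *)
  pose c0 := if recvs e j i then behead (gs_chan g j i) else gs_chan g j i.
  have hc0 : c0 = [seq msg (gs_loc g' j) s | s <- iota (nxt g j i + recvs e j i)%N (size c0)]
      /\ (nxt g j i + recvs e j i + size c0)%N = (ls_s (gs_loc g j)).+1.
    rewrite /c0; case: ifP => hr; last first.
      have h2 : (nxt g j i + size (gs_chan g j i))%N = (ls_s (gs_loc g j)).+1.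
        by rewrite /nxt; lia.
      rewrite addn0 -hmm -?inv_chan //; last by rewrite h2.
      by rewrite /nxt; lia.
    move: hr; rewrite /recvs; case: e st {hs c hc c0} => // i' j' st /andP [/eqP ei /eqP ej].
    rewrite {}ei {}ej in st; have [w [rest [hw _ _ _]]] := ss_recv st erefl.
    have [_ h2 hr] := inv_head ig hw.
    have hsz : ((nxt g j i).+1 + size rest)%N = (ls_s (gs_loc g j)).+1.
      by move: hz; rewrite /nxt hw /=; lia.
    by rewrite hw /= addn1 -hmm //; lia.
  case: hc0 => hc1 hc2; rewrite hc -/c0 size_cat size_nseq iotaD map_cat hc2.
  congr (_ ++ _); first exact: hc1.
  have [->|->] : ls_s (gs_loc g' j) = ls_s (gs_loc g j) \/
                 ls_s (gs_loc g' j) = (ls_s (gs_loc g j)).+1 by lia.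
    by rewrite subnn.
  by rewrite subSnn.
- move=> j i; rewrite hs; have := inv_nxt ig j i; have := ext_dn (ss_ext st i).
  case hr: (recvs e j i) => /=; last by lia.
  move: hr; rewrite /recvs; case: e st {hs} => // i' j' st /andP [/eqP ei /eqP ej].
  rewrite {}ei {}ej in st; have [w [rest [hw ph _ ->]]] := ss_recv st erefl.
  (* A message beyond the current step completes that step, so [dn] grows along with [nxt]; for any
     other message the bound had room for one more. *)
  have := newR_full ig hw ph; rewrite (dn_wait ph); have := linv_wait_ge2 (il i) ph.
  by case: (leqP tr) => h; lia.
- move=> i j s p hp.
  have [h ->] : 2 <= s <= ls_s (gs_loc g j) /\ p = pl (gs_loc g j) s.
    case: (ss_R st hp) => [/(inv_R ig)//|[es [a ea]]]; move: hp; rewrite {}es.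
    have [w [rest [hw ph -> _]]] := ss_recv st ea.
    exact: (inv_newR ig hw ph).
  split; first by have := he j; lia.
  by rewrite (pl_ext (il j) (ss_ext st j)).
Qed.

(** * Counting arguments and membership in the output sets *)

(** Turns the size of a receive set into a number of senders: projection to the sender is injective
    because [F] fixes the payload. *)
Lemma card_graph X (F : node n -> payload M) :
  (forall j p, (j, p) \in X -> p = F j) -> #|` X| = #|[set j | (j, F j) \in X]|.
Proof.
move=> hF; rewrite cardE -(size_map fst); apply: perm_size; apply: uniq_perm.
- rewrite map_inj_in_uniq ?fset_uniq // => -[a p] [b q] hp hq /= ab.
  by rewrite ab (hF _ _ hp) (hF _ _ hq) ab.
- exact: enum_uniq.
move=> j; rewrite mem_enum inE; apply/mapP/idP => [[[a p] hp /= ->]|hj].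
  by rewrite -(hF _ _ hp).
by exists (j, F j).
Qed.

(* Each [j] outside [N] is missed by at least [#|A| - ts + 1] of the
   sets [S p], while every [S p] misses at most [n - tr] elements. *)
Lemma count_bound (A N : {set 'I_n}) (S : 'I_n -> {set 'I_n}) :
  0 < tr -> 0 < ts -> ts <= tr -> tr <= #|A| -> (forall p, p \in A -> tr <= #|S p|) ->
  (forall j, j \notin N -> #|[set p in A | j \in S p]| < ts) ->
  ((n - #|N|) * (tr - ts + 1) <= tr * (n - tr))%N.
Proof.
move=> t0 s0 st hA hS hN.
have missed j : j \notin N -> (#|A| - ts + 1)%N <= #|[set p in A | j \notin S p]|.
  move=> /hN h.
  have e : (#|[set p in A | j \in S p]| + #|[set p in A | j \notin S p]|)%N = #|A|.
    rewrite -(cardsID [set p | j \in S p] A); congr (_ + _)%N; apply: eq_card => p.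
      by rewrite !inE.
    by rewrite !inE andbC.
  by move: h e; move: #|_| => a; move: #|_| => b; lia.
have : ((n - #|N|) * (#|A| - ts + 1) <= #|A| * (n - tr))%N.
  have -> : (n - #|N|)%N = #|~: N| by rewrite [RHS]cardsCs setCK card_ord.
  rewrite -sum_nat_const -[X in _ <= X]sum_nat_const.
  apply: (@leq_trans (\sum_(j in ~: N) \sum_(p in A) (j \notin S p)))%N.
    apply: leq_sum => j; rewrite inE => /missed h; apply: leq_trans h _.
    rewrite -sum1_card big_mkcond [X in _ <= X]big_mkcond /=; apply: leq_sum => p _.
    by rewrite inE; case: (p \in A); case: (j \in S p).
  rewrite exchange_big /=; apply: leq_sum => p /hS hp.
  apply: (@leq_trans #|~: S p|); last by rewrite [#|_|]cardsCs setCK card_ord; lia.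
  rewrite -sum1_card big_mkcond [X in _ <= X]big_mkcond /=; apply: leq_sum => j _.
  by rewrite !inE; case: (j \in N); case: (j \in S p).
(* The two sides differ by [(#|A| - tr) * (ts - 1)]; this replaces [#|A|] by its lower bound
   [tr]. *)
have : (#|A| * (tr - ts + 1) <= tr * (#|A| - ts + 1))%N by nia.
set e := (n - #|N|)%N; set c := #|A| in hA *; set d := (n - tr)%N => h1 h2.
have c0 : 0 < c by exact: leq_trans hA.
rewrite -(leq_pmul2l c0).
apply: (@leq_trans (tr * (e * (c - ts + 1)))%N); first by nia.
by rewrite [(c * _)%N]mulnCA leq_mul2l h2 orbT.
Qed.

Lemma mem_vals1 X x : reflect (exists j, (j, inl x) \in X) (x \in vals1 X).
Proof.
rewrite /vals1 in_fset /= mem_pmap; apply: (iffP mapP) => [[p /mapP[[j q] hq ->] /=]|[j hj]].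
  by case: q hq => //= m hq [->]; exists j.
by exists (inl x) => //; apply/mapP; exists (j, inl x).
Qed.

Lemma mem_outR X1 X2 x : reflect
  (x \in vals1 X1 \/ exists j Y, (j, inr Y) \in X2 /\ x \in Y) (x \in outR X1 X2).
Proof.
rewrite /outR in_fsetU; apply: (iffP orP) => -[h|h]; [by left| |by left|].
  right; case/bigfcupP: h => [[j [m|Y]] /andP[hj _]] //= hx.
  by exists j, Y.
right; case: h => j [Y [hj hY]].
by apply/bigfcupP; exists (j, inr Y); rewrite ?hj.
Qed.

Lemma mem_outB X1 X2 x : x \in outB X1 X2 =
  (x \in outR X1 X2) && (ts <= #|` [fset p in X2 | x \in get2 p.2]|).
Proof. by rewrite /outB !inE. Qed.

(** * Safety of call [k], read off a single state *)

Section Safety.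
Variables (g : gstate M n) (ig : inv g) (k : nat).

Let R1 i := ls_R (gs_loc g i) k.*2.
Let R2 i := ls_R (gs_loc g i) k.*2.+1.
Let V i := vals1 (R1 i).

(** Takes every node whose message lies in [Y], not one per message, so that nodes are counted even
    when messages coincide. *)
Definition msgset (Y : {fset M}) : {set 'I_n} :=
  [set j | if ls_inp (gs_loc g j) k is Some m then m \in Y else false].

Definition senders i s : {set 'I_n} :=
  [set j | (j, pl (gs_loc g j) s) \in ls_R (gs_loc g i) s].

Lemma card_senders i s : #|` ls_R (gs_loc g i) s| = #|senders i s|.
Proof. by apply: card_graph => j p /(inv_R ig) []. Qed.

Lemma inv_R1 i j p : (j, p) \in R1 i ->
  exists2 m, ls_inp (gs_loc g j) k = Some m & p = inl m.
Proof.
case/(inv_R ig) => hs ->; rewrite /pl odd_double doubleK.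
have : isSome (ls_inp (gs_loc g j) k).
  by rewrite (linv_inp (inv_linv ig j)); have := linv_s (inv_linv ig j); lia.
by case: (ls_inp _ _) => // m _; exists m.
Qed.

(** A node sends its second-step message only after completing step [k.*2], so [V j] is final and is
    the set that was sent. *)
Lemma inv_R2 i j p : (j, p) \in R2 i ->
  [/\ 0 < k, k.*2 <= dn (gs_loc g j) & p = inr (V j)].
Proof.
case/(inv_R ig) => hs ->; rewrite /pl /= odd_double /=.
by have := s_le_dn (gs_loc g j); split=> //; lia.
Qed.

Lemma V_inp i x : x \in V i -> exists j, ls_inp (gs_loc g j) k = Some x.
Proof. by case/mem_vals1 => j /inv_R1 [m hm [->]]; exists j. Qed.

Lemma outR_inp i x : x \in outR (R1 i) (R2 i) -> exists j, ls_inp (gs_loc g j) k = Some x.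
Proof.
by case/mem_outR => [/V_inp//|[j [Y [/inv_R2 [_ _ [->]] /V_inp]]]].
Qed.

Lemma outB_sub_outR i : outB (R1 i) (R2 i) `<=` outR (R1 i) (R2 i).
Proof. by apply/fsubsetP => x; rewrite mem_outB => /andP[]. Qed.

Lemma senders1 j a : a \in senders j k.*2 -> exists2 m,
  ls_inp (gs_loc g a) k = Some m & m \in V j.
Proof.
rewrite inE => h; have [m hm hp] := inv_R1 h; exists m => //.
by apply/mem_vals1; exists a; rewrite -hp.
Qed.

Lemma senders2 i a : a \in senders i k.*2.+1 -> (a, inr (V a)) \in R2 i.
Proof. by rewrite inE => h; have [_ _ <-] := inv_R2 h. Qed.

Lemma card_senders1 a : 0 < k -> k.*2 <= dn (gs_loc g a) -> tr <= #|senders a k.*2|.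
Proof. by move=> k0 h; rewrite -card_senders; apply: (linv_done (inv_linv ig a)); lia. Qed.

Lemma card_senders2 i : 0 < k -> k.*2.+1 <= dn (gs_loc g i) ->
  tr <= #|senders i k.*2.+1|.
Proof. by move=> k0 hk; rewrite -card_senders; apply: (linv_done (inv_linv ig i)); lia. Qed.

Lemma card_supporters i x : #|` [fset p in R2 i | x \in get2 p.2]| =
  #|[set a in senders i k.*2.+1 | x \in V a]|.
Proof.
rewrite (@card_graph _ (fun a => inr (V a))); last first.
  by move=> a p; rewrite !inE => /andP [/inv_R2 []].
apply: eq_card => a; rewrite !inE /=; apply: andb_id2r => _.
by apply/idP/idP => h; [have [_ <-] := inv_R ig h | have [_ _ <-] := inv_R2 h].
Qed.

(** The nodes heard in the first step alone already number [tr]. *)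
Lemma outR_card i : 0 < k -> k.*2.+1 <= dn (gs_loc g i) ->
  tr <= #|msgset (outR (R1 i) (R2 i))|.
Proof.
move=> k0 hk; apply: leq_trans (card_senders1 k0 (ltnW hk)) _; apply: subset_leq_card.
apply/subsetP => a /senders1 [m hm mV]; rewrite inE hm.
by apply/mem_outR; left.
Qed.

(** [count_bound] with [A] the nodes heard by [i] in the second step and [S p] the nodes heard by
    [p] in the first. *)
Lemma outB_card i : 0 < tr -> 0 < ts -> ts <= tr ->
  0 < k -> k.*2.+1 <= dn (gs_loc g i) ->
  ((n - #|msgset (outB (R1 i) (R2 i))|) * (tr - ts + 1) <= tr * (n - tr))%N.
Proof.
move=> t0 s0 st k0 hk; apply: (@count_bound (senders i k.*2.+1) _ (fun p => senders p k.*2)) => //.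
- exact: card_senders2.
- by move=> p /senders2 /inv_R2 [_ hp _]; exact: card_senders1.
move=> j; rewrite inE; case hj: (ls_inp (gs_loc g j) k) => [m|] hm.
- rewrite ltnNge; apply: contra hm => hc.
  (* Only an inclusion is available: a supporter of [m] may have got it from another node that sent
     the same message. *)
  have hc' : ts <= #|[set p in senders i k.*2.+1 | m \in V p]|.
    apply: leq_trans hc (subset_leq_card _); apply/subsetP => p.
    rewrite !in_set => /andP [-> hp]; have : j \in senders p k.*2 by rewrite in_set.
    by case/senders1 => m'; rewrite hj => -[<-].
  rewrite mem_outB card_supporters hc' andbT.
  have /card_gt0P [p] := leq_trans s0 hc'.
  rewrite in_set => /andP [/senders2 hp mp].
  by apply/mem_outR; right; exists p, (V p).
(* A node without a [k]-th message has been heard by nobody in that step. *)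
rewrite (_ : [set p in _ | _] = set0) ?cards0 //; apply/setP => p; rewrite !in_set.
apply/negbTE; rewrite negb_and; apply/orP; right; apply/negP => hp.
have : j \in senders p k.*2 by rewrite in_set.
by case/senders1 => m'; rewrite hj.
Qed.

(* The [ts] senders supporting [x] meet the [tr] senders heard by any node. *)
Lemma outB_spread i i' x : n < tr + ts -> 0 < k -> k.*2.+1 <= dn (gs_loc g i') ->
  x \in outB (R1 i) (R2 i) -> x \in outR (R1 i') (R2 i').
Proof.
move=> nt k0 hk'; rewrite mem_outB card_supporters => /andP [_ hx].
have h2 : tr <= #|senders i' k.*2.+1| by exact: card_senders2.
set A := [set a in _ | _] in hx.
have : 0 < #|A :&: senders i' k.*2.+1|.
  rewrite -(ltn_add2l #|A :|: senders i' k.*2.+1|) addn0 cardsUI.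
  apply: (@leq_ltn_trans n); first by apply: leq_trans (max_card _) _; rewrite card_ord.
  by apply: leq_trans nt _; rewrite addnC leq_add.
case/card_gt0P => a; rewrite !in_set => /andP [/andP [_ hV] ha].
apply/mem_outR; right; exists a, (V a); split=> //.
by have [_ _ <-] := inv_R2 ha.
Qed.

End Safety.

(** * Executions: transfer of the invariants and the safety clauses *)

Section Execution.
Variables (f : nat) (sigma : nat -> gstate M n) (ev : nat -> event M n).
Hypotheses (t0 : 0 < tr) (vx : valid_exec tr ts f sigma ev).

Lemma exec_inv t : inv (sigma t).
Proof.
case: vx => h0 hstep _ _ _; elim: t => [|t ih]; first by rewrite h0; exact: inv_init.
exact: inv_step ih (step_spec t0 (inv_linv ih) (hstep t)).
Qed.

Lemma exec_step t : step_sum (sigma t) (ev t) (sigma t.+1).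
Proof.
by case: vx => _ hstep _ _ _; exact: step_spec t0 (inv_linv (exec_inv t)) (hstep t).
Qed.

Lemma exec_ext t t' i : t <= t' -> ext (gs_loc (sigma t) i) (gs_loc (sigma t') i).
Proof.
move=> /subnKC <-; elim: (t' - t)%N => [|d ih]; first by rewrite addn0; exact: ext_refl.
by rewrite addnS; apply: ext_trans ih (ss_ext (exec_step _) i).
Qed.

Lemma exec_nxt t t' j i : t <= t' -> nxt (sigma t) j i <= nxt (sigma t') j i.
Proof.
move=> /subnKC <-; elim: (t' - t)%N => [|d ih]; first by rewrite addn0.
rewrite addnS (nxt_step j i (exec_inv _) (exec_step _)).
exact: leq_trans ih (leq_addr _ _).
Qed.

Lemma bcast_in_at t j k m m' : bcast_in sigma j k m ->
  ls_inp (gs_loc (sigma t) j) k = Some m' -> m = m'.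
Proof.
case=> t1 /(ext_inp (exec_ext j (leq_maxl t1 t))) h1.
by move=> /(ext_inp (exec_ext j (leq_maxr t1 t))); rewrite h1 => -[].
Qed.

Lemma exactly_from_msgset t k (Y : {fset M}) :
  (forall x, x \in Y -> exists j, ls_inp (gs_loc (sigma t) j) k = Some x) ->
  exactly_from sigma (msgset (sigma t) k Y) k Y.
Proof.
move=> hY; split=> [j|x].
  by rewrite inE; case E: (ls_inp _ _) => [m|//] _; exists m, t.
split=> [hx|[j]].
  by have [j hj] := hY x hx; exists j; [rewrite inE hj | exists t].
by rewrite inE; case E: (ls_inp _ _) => [m|//] hm /bcast_in_at /(_ E) ->.
Qed.

(** Stated for all later states, so that the returns of two nodes can be compared in a common
    one. *)
Lemma returned_from i k R B : returned sigma i k R B -> exists t, forall t', t <= t' ->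
  let l := gs_loc (sigma t') i in
  [/\ 0 < k, k.*2.+1 <= dn l, R = outR (ls_R l k.*2) (ls_R l k.*2.+1)
    & B = outB (ls_R l k.*2) (ls_R l k.*2.+1)].
Proof.
case=> t ht; exists t => t' /(exec_ext i) /ext_out /(_ _ _ ht).
by rewrite (linv_out (inv_linv (exec_inv t') i)); case: ifP => // /andP [? ?] [<- <-].
Qed.

Lemma receive_threshold i k R B : returned sigma i k R B ->
  exists N : {set node n}, tr <= #|N| /\ exactly_from sigma N k R.
Proof.
case/returned_from => t /(_ t (leqnn t)) /= [k0 hk eR _].
exists (msgset (sigma t) k R); rewrite eR; split; first exact: (outR_card (exec_inv t)).
by apply: exactly_from_msgset => x; exact: (outR_inp (exec_inv t)).
Qed.

Lemma spread i k R B : n < tr + ts ->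
  returned sigma i k R B -> forall x, x \in B ->
  forall j R' B', returned sigma j k R' B' -> x \in R'.
Proof.
move=> nt /returned_from [t ht] x hx j R' B' /returned_from [t' ht'].
have [k0 hk _ eB] := ht _ (leq_maxl t t'); have [_ hk' -> _] := ht' _ (leq_maxr t t').
by apply: (@outB_spread _ (exec_inv _) k i j) => //; rewrite -eB.
Qed.

Lemma broadcast_threshold tb i k R B : 0 < ts -> ts <= tr ->
  (tb%:R <= n%:R - f_b n tr ts :> rat)%R -> returned sigma i k R B ->
  exists N : {set node n}, tb <= #|N| /\ exactly_from sigma N k B.
Proof.
move=> s0 st htb /returned_from [t /(_ t (leqnn t)) /= [k0 hk _ eB]].
exists (msgset (sigma t) k B); rewrite eB; split; last first.
  apply: exactly_from_msgset => x /(fsubsetP (outB_sub_outR _ _ _)).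
  exact: (outR_inp (exec_inv t)).
set N := msgset _ _ _.
have hN : ((n - #|N|) * (tr - ts + 1) <= tr * (n - tr))%N by exact: (outB_card (exec_inv t)).
have hn : #|N| <= n by apply: leq_trans (max_card _) _; rewrite card_ord.
exact: f_b_bound hn hN htb.
Qed.

(** * Liveness: every correct node reaches every step *)

Let S t i := ls_s (gs_loc (sigma t) i).
Let C : {set node n} := [set i | `[< correct sigma i >]].

Lemma eventually_all (A : {set node n}) (P : node n -> nat -> Prop) :
  (forall i t t', P i t -> t <= t' -> P i t') -> (forall i, i \in A -> exists t, P i t) ->
  exists T, forall i, i \in A -> P i T.
Proof.
move=> mono ex; have /choice [h hP] : forall i, exists t, i \in A -> P i t.
  by move=> i; case: (boolP (i \in A)) => [/ex [t]|]; [exists t | exists 0].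
exists (\max_i h i) => i /hP hi; apply: mono hi _.
exact: leq_bigmax.
Qed.

(** Crashes are permanent and nodes finitely many, so at some moment all faulty nodes have crashed;
    the bound [f] is applied there. *)
Lemma card_correct : n - f <= #|C|.
Proof.
case: vx => _ _ hf _ _.
have [T hT] : exists T, forall i, i \in ~: C -> crashed_at sigma T i.
  apply: (@eventually_all (~: C) (fun i t => crashed_at sigma t i)).
    by move=> i t t' h /(exec_ext i) /ext_crashed; apply.
  move=> i; rewrite !inE => /asboolPn hi; apply: contrapT => h.
  by apply: hi => t; apply/negP => ht; apply: h; exists t.
have : #|~: C| <= f.
  apply: leq_trans (hf T); apply: subset_leq_card; apply/subsetP => i /hT.
  by rewrite inE.
by have := cardsC C; rewrite card_ord; lia.
Qed.

(** Fairness only speaks of the head of a channel; the induction is on the number of messages from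
    the head up to step [v]. *)
Lemma exec_consume i j v t : i \in C -> v <= S t j ->
  exists2 t', t <= t' & v < nxt (sigma t') j i.
Proof.
rewrite inE => /asboolP hi; have [d] := ubnP (v.+1 - nxt (sigma t) j i).
elim: d t => // d ih t hd hv.
case: (ltnP v (nxt (sigma t) j i)) => hlt; first by exists t.
case: vx => _ _ _ fair _.
have [|t1 ht1 et1] := fair i j t hi.
  by move=> e; move: hlt hv; rewrite /nxt e /S /=; lia.
have h1 := nxt_step j i (exec_inv t1) (exec_step t1).
have h2 := exec_nxt j i ht1.
rewrite et1 /recvs !eqxx in h1.
have [||t' ht' h'] := ih t1.+1; first by lia.
  by apply: leq_trans hv (ext_s (exec_ext j _)); lia.
by exists t' => //; lia.
Qed.

Lemma idle_progress i t : i \in C -> ls_phase (gs_loc (sigma t) i) = Idle _ ->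
  exists t', S t i < S t' i.
Proof.
rewrite inE => /asboolP hi hid; case: vx => _ _ _ _ inv_.
have [t' ht' [m et']] := inv_ i t hi hid; exists t'.+1.
rewrite /S (ss_invoke (exec_step t') et') ltnS.
exact: ext_s (exec_ext i ht').
Qed.

(** A message broadcast in a transition is not read in that same transition. *)
Lemma nxt_fresh g e g' j i : step_sum g e g' -> nxt g' j i <= (ls_s (gs_loc g j)).+1.
Proof. by move=> st; rewrite /nxt (ss_chan st) size_cat size_nseq; lia. Qed.

(* The message of [j] of step [s] can be lost to [i] (received while [i] is still
   in step [s - 1]) only if [j] enters step [s] before [i]. *)
Lemma first_not_lost s i j T : 2 <= s -> S T j < s ->
  (forall t, T < t -> S t i = s) -> forall t, T < t ->
  nxt (sigma t) j i <= s \/ exists p, (j, p) \in ls_R (gs_loc (sigma t) i) s.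
Proof.
move=> s2 hj hi; elim=> // t ih; rewrite ltnS leq_eqVlt => /orP [/eqP <-|hT].
  left; apply: leq_trans (nxt_fresh j i (exec_step T)) _; exact: hj.
have es := hi _ hT; case: (ih hT) => [hn|[p hp]]; last first.
  right; exists p; have hs : s <= ls_s (gs_loc (sigma t) i) by rewrite -es.
  exact: (fsubsetP (ext_R (ss_ext (exec_step t) i) hs)).
rewrite (nxt_step j i (exec_inv t) (exec_step t)).
case hr: (recvs _ _ _); last by left; rewrite addn0.
move: hn; rewrite leq_eqVlt => /orP [/eqP hn|hn]; last by left; rewrite addn1.
right; move: hr; rewrite /recvs; case E: (ev t) => [//|i' j'|//|//].
case/andP => /eqP ei /eqP ej; rewrite {}ei {}ej in E.
have [w [rest [hw ph hR _]]] := ss_recv (exec_step t) E.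
have [ew _ _] := inv_head (exec_inv t) hw.
exists (nm_pl w); move: hR; rewrite -/(S t i) es => ->.
by rewrite /newR -/(S t i) es ew /= hn eqxx fset1U1.
Qed.

Hypothesis trf : tr <= n - f.

Lemma some_progress s : 0 < s -> (forall i, i \in C -> exists t, s <= S t i) ->
  exists2 j, j \in C & exists t, s < S t j.
Proof.
move=> s1 hs; apply: contrapT => H0.
have H j t : j \in C -> S t j <= s.
  by move=> hj; rewrite leqNgt; apply/negP => h; apply: H0; exists j => //; exists t.
have [T hT] : exists T, forall i, i \in C -> s <= S T i.
  apply: (@eventually_all C (fun i t => s <= S t i)) => // i t t' h /(exec_ext i) /ext_s.
  exact: leq_trans h.
(* From [T] on every correct node waits inside step [s]: an idle one would be invoked again and pass
   [s]. *)
have active t i : T <= t -> i \in C -> ls_phase (gs_loc (sigma t) i) <> Idle _ /\ S t i = s.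
  move=> ht hi.
  have es : S t i = s.
    by apply/eqP; rewrite eqn_leq H //=; apply: leq_trans (hT i hi) (ext_s (exec_ext i ht)).
  by split=> // /(idle_progress hi) [t']; rewrite es ltnNge H.
have hC : tr <= #|C| := leq_trans trf card_correct.
have [i1 hi1] : exists i, i \in C by apply/card_gt0P; exact: leq_trans hC.
have s2 : 2 <= s.
  have [ph <-] := active T i1 (leqnn T) hi1.
  exact: linv_wait_ge2 (inv_linv (exec_inv T) i1) ph.
have exP : exists t, [exists i in C, s <= S t i].
  by exists T; apply/existsP; exists i1; rewrite hi1 hT.
case: (ex_minnP exP) => T0 /existsP [i0 /andP [hi0 hi0s]] minT0.
have hT0 : T0 <= T by apply: minT0; apply/existsP; exists i1; rewrite hi1 hT.
(* Nodes start in step 1, below [s], so the first arrival is not at time 0. From here [T0] is the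
   moment just before it, when all correct nodes are below [s]. *)
case: T0 => [|T0] in hi0s minT0 hT0.
  by move: hi0s; rewrite /S; case: vx => -> _ _ _ _ /=; lia.
have before j : j \in C -> S T0 j < s.
  move=> hj; rewrite ltnNge; apply/negP => h.
  suff : T0 < T0 by rewrite ltnn.
  by apply: minT0; apply/existsP; exists j; rewrite hj h.
have stay t : T0 < t -> S t i0 = s.
  move=> ht; apply/eqP; rewrite eqn_leq H //=.
  exact: leq_trans hi0s (ext_s (exec_ext i0 ht)).
(* By [T1] node [i0] has read the step [s] message of every correct node. None was lost, so its set
   holds at least [tr] entries although it is still waiting. *)
have [T1 hT1] : exists T1, forall j, j \in C -> T <= T1 /\ s < nxt (sigma T1) j i0.
  apply: (@eventually_all C (fun j t => T <= t /\ s < nxt (sigma t) j i0)).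
    by move=> j t t' [h1 h2] ht; have := exec_nxt j i0 ht; lia.
  by move=> j hj; have [t h1 h2] := exec_consume hi0 (hT j hj); exists t.
have [hTT1 _] := hT1 i0 hi0.
have [ph _] := active T1 i0 hTT1 hi0.
have hT01 : T0 < T1 by exact: leq_trans hTT1.
have := linv_wait (inv_linv (exec_inv T1) i0) ph.
rewrite -/(S T1 i0) (stay _ hT01) (card_senders (exec_inv T1)) ltnNge => /negP; apply.
apply: leq_trans hC (subset_leq_card _); apply/subsetP => j hj.
have [hn|[p hp]] := first_not_lost s2 (before j hj) stay hT01.
  by have [_] := hT1 j hj; rewrite ltnNge hn.
by rewrite inE; have [_ <-] := inv_R (exec_inv T1) hp.
Qed.

Lemma all_progress s i : i \in C -> exists t, s <= S t i.
Proof.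
elim: s i => [|s ih] i hi; first by exists 0.
case: (posnP s) => [->|s1].
  by exists 0; rewrite /S; case: vx => -> _ _ _ _.
have [j hj [t1 ht1]] := some_progress s1 ih.
have [T hT] := ih i hi.
apply: contrapT => H0.
have H t : S t i <= s by rewrite leqNgt; apply/negP => h; apply: H0; exists t.
have hv : s.+1 <= S (maxn T t1) j.
  exact: leq_trans ht1 (ext_s (exec_ext j (leq_maxr _ _))).
have [t' ht' hn] := exec_consume hi hv.
have es : S t' i = s.
  apply/eqP; rewrite eqn_leq H /=; apply: leq_trans hT (ext_s (exec_ext i _)).
  exact: leq_trans (leq_maxl _ _) ht'.
(* Having read the message of step [s.+1] makes [nxt] at least [s.+2], but a node waiting in step
   [s] allows at most [s.+1]. *)
have := inv_nxt (exec_inv t') j i.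
have ph : ls_phase (gs_loc (sigma t') i) <> Idle _.
  by move/(idle_progress hi) => [t2]; rewrite es ltnNge H.
by rewrite (dn_wait ph) -/(S t' i) es; lia.
Qed.

Lemma lock_step i k m : bcast_in sigma i k m -> correct sigma i ->
  exists R B, returned sigma i k R B.
Proof.
case=> t hm hi.
have : isSome (ls_inp (gs_loc (sigma t) i) k) by rewrite hm.
rewrite (linv_inp (inv_linv (exec_inv t) i)) => /andP [k0 _].
(* Entering step [k.*2.+2] requires having completed [k.*2.+1], the second step of call [k]. *)
have [|t' ht'] := @all_progress k.*2.+2 i; first by rewrite inE; apply/asboolP.
have hd := s_le_dn (gs_loc (sigma t') i).
do 2!eexists; exists t'; rewrite (linv_out (inv_linv (exec_inv t') i)) ifT //.
by rewrite k0 /=; move: ht' hd; rewrite /S; lia.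
Qed.

End Execution.

End TLCB.

(** * The four clauses of the broadcast abstraction *)

Theorem theorem4 (M : choiceType) (n f tr ts tb : nat)
  (sigma : nat -> gstate M n) (ev : nat -> event M n) :
  0 < tr -> tr <= n - f ->
  0 < ts -> ts <= tr ->
  n < tr + ts ->
  0 < tb -> (tb%:R <= n%:R - f_b n tr ts :> rat)%R ->
  valid_exec tr ts f sigma ev ->
  TSB sigma tr tb n.
Proof.
move=> t0 trf s0 st nt _ htb vx; split.
- move=> i k m hm hi; exact: (lock_step t0 vx trf hm hi).
- by move=> i k R B; exact: receive_threshold t0 vx _ _ _ _.
- by move=> i k R B; exact: (broadcast_threshold t0 vx s0 st htb).
(* All nodes serve as witness: [spread] covers each one whose call returns. *)
move=> i k R B h x hx; exists [set: node n]; split; first by rewrite cardsT card_ord.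
by move=> j _ R' B'; exact: (spread t0 vx nt h hx).
Qed.
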